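(* Let $w$ be an outer commutator word in $r$ variables and let $\mathbf{N}=(N_1,\ldots,N_r)$ be a tuple of normal subgroups of a group $G$. Assume that $N_i=\langle S_i\rangle$ for every $i=1,\ldots,r$, where (i) $S_i$ is a normal subset of $G$, and (ii) there exists $n_i\in\mathbb{N}$ such that all $n_i$th powers of elements of $N_i$ lie in $S_i$. If for the tuple $\mathbf{S}=(S_1,\ldots,S_r)$ the set $w\{\mathbf{S}\}$ is finite of order $m$, then the subgroup $w(\mathbf{N})$ is finite, and its order is bounded by a function of $m,r,n_1,\ldots,n_r$ only.
   Context: Outer commutator words are defined recursively: every single variable is an outer commutator word, and if $\alpha,\beta$ are outer commutator words in disjoint sets of variables then $[\alpha,\beta]$ is an outer commutator word. A normal subset of $G$ is a subset closed under conjugation by elements of $G$. For a tuple $\mathbf{S}=(S_1,\ldots,S_r)$ of subsets of $G$, $w\{\mathbf{S}\}$ is the set of values $w(g_1,\ldots,g_r)$ with $g_i\in S_i$, and $w(\mathbf{S})$ is the subgroup generated by $w\{\mathbf{S}\}$; $w(\mathbf{N})$ is defined likewise. *)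

(* Defs.v *)
From Stdlib Require Import List Arith Permutation.
Import ListNotations.

Record Group := {
  carrier :> Type;
  gmul : carrier -> carrier -> carrier;
  gone : carrier;
  ginv : carrier -> carrier;
  gmul_assoc : forall x y z, gmul x (gmul y z) = gmul (gmul x y) z;
  gmul_1l : forall x, gmul gone x = x;
  gmul_1r : forall x, gmul x gone = x;
  gmul_Vl : forall x, gmul (ginv x) x = gone;
  gmul_Vr : forall x, gmul x (ginv x) = gone
}.

Arguments gmul {g} _ _.
Arguments gone {g}.
Arguments ginv {g} _.

Definition gcomm {G : Group} (x y : G) : G :=
  gmul (gmul (ginv x) (ginv y)) (gmul x y).

Definition gconj {G : Group} (x g : G) : G := gmul (ginv g) (gmul x g).

Fixpoint gpow {G : Group} (x : G) (n : nat) : G :=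
  match n with 0 => gone | S k => gmul x (gpow x k) end.

Inductive gen {G : Group} (A : G -> Prop) : G -> Prop :=
  | gen_in x : A x -> gen A x
  | gen_one : gen A gone
  | gen_mul x y : gen A x -> gen A y -> gen A (gmul x y)
  | gen_inv x : gen A x -> gen A (ginv x).

Definition normal_subset {G : Group} (S : G -> Prop) : Prop :=
  forall x g, S x -> S (gconj x g).

Definition normal_subgroup {G : Group} (N : G -> Prop) : Prop :=
  N gone /\ (forall x y, N x -> N y -> N (gmul x y)) /\
  (forall x, N x -> N (ginv x)) /\ (forall x g, N x -> N (gconj x g)).

Inductive ocword : Type :=
  | OVar (i : nat)
  | OComm (a b : ocword).

Fixpoint ocvars (w : ocword) : list nat :=
  match w with OVar i => [i] | OComm a b => ocvars a ++ ocvars b end.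

(* w is an outer commutator word in the r variables x_0, ..., x_{r-1}:
   each variable occurs exactly once (so the two sides of every commutator
   involve disjoint sets of variables). *)
Definition is_ocword (w : ocword) (r : nat) : Prop :=
  Permutation (ocvars w) (seq 0 r).

Fixpoint oceval {G : Group} (w : ocword) (g : nat -> G) : G :=
  match w with
  | OVar i => g i
  | OComm a b => gcomm (oceval a g) (oceval b g)
  end.

Definition wvalues {G : Group} (w : ocword) (S : nat -> G -> Prop) : G -> Prop :=
  fun y => exists g : nat -> G, (forall i, In i (ocvars w) -> S i (g i)) /\ y = oceval w g.

Definition wsubgroup {G : Group} (w : ocword) (S : nat -> G -> Prop) : G -> Prop :=
  gen (wvalues w S).

Definition has_card {T : Type} (A : T -> Prop) (m : nat) : Prop :=
  exists l : list T, NoDup l /\ length l = m /\ forall y, A y <-> In y l.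

(* Main.v *)
Require Import Defs.
From Stdlib Require Import List Arith Lia Permutation.
From Stdlib Require Import Classical ClassicalEpsilon.
Import ListNotations.

(** Let W = w(N). Since the S_i are normal subsets, W is generated by the finite
    normal set w{S}, so by Dietzmann's lemma it suffices to bound the orders of
    the elements of w{S}; as W' is finite by Schur's theorem, it suffices to
    bound the exponent of W/W'. For this one shows by induction on the word that,
    modulo a normal subgroup K for which x |-> [x, y_1, ..., y_q] is
    multiplicative on W, the subgroup generated by the [x, y_1, ..., y_q] has
    bounded exponent. The source of torsion is that a w-value that is
    multiplicative in a variable x_i modulo K has all its (n_i k)-th powers in
    w{S} modulo K, hence finite order modulo K. *)

(** A w-value is in general not a homomorphism in x_i over all of N_i, so hypothesis (ii) gives no
    torsion directly. What is available at the start is the empty context: W is abelian modulo W'.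
    From this, a commutator becomes multiplicative in an entry once that entry is restricted to W.
    Hence W must be brought inside a subgroup in which a variable ranges over W only. This is
    possible only up to bounded powers: each appeal to the induction hypothesis takes a larger
    modulus, K times the next subgroup of a chain, and contributes one factor to the exponent. The
    contexts grow along the chain, and every added entry squares the number of values to be counted.
    Hypothesis (ii) is applied to all powers x^(nk) at once, which is what pigeonhole on the finite
    set of values requires. *)

(** * Group identities, powers and pigeonhole *)

Lemma gmul_cancel_l (G : Group) (x y z : G) : gmul x y = gmul x z -> y = z.
Proof.
  intros H. rewrite <- (gmul_1l G y), <- (gmul_1l G z), <- (gmul_Vl G x).
  now rewrite <- !gmul_assoc, H.
Qed.

Lemma gmul_Kl (G : Group) (x y : G) : gmul x (gmul (ginv x) y) = y.
Proof. now rewrite gmul_assoc, gmul_Vr, gmul_1l. Qed.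

Lemma gmul_VKl (G : Group) (x y : G) : gmul (ginv x) (gmul x y) = y.
Proof. now rewrite gmul_assoc, gmul_Vl, gmul_1l. Qed.

Lemma ginv_unique (G : Group) (x y : G) : gmul x y = gone -> ginv x = y.
Proof. intros H. apply (gmul_cancel_l G x). now rewrite gmul_Vr, H. Qed.

Lemma ginv_mul (G : Group) (x y : G) :
  ginv (gmul x y) = gmul (ginv y) (ginv x).
Proof.
  apply ginv_unique. now rewrite <- gmul_assoc, gmul_Kl, gmul_Vr.
Qed.

Lemma ginv_inv (G : Group) (x : G) : ginv (ginv x) = x.
Proof. apply ginv_unique, gmul_Vl. Qed.

Lemma ginv_one (G : Group) : ginv gone = (@gone G).
Proof. apply ginv_unique, gmul_1l. Qed.

Lemma gmul_assoc_r (G : Group) (x y z : G) :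
  gmul (gmul x y) z = gmul x (gmul y z).
Proof. now rewrite gmul_assoc. Qed.

(* These ten rules are the convergent rewriting system for free groups, so [grp] settles every
   commutator identity that holds in all groups. *)
Create HintDb grp.
#[global] Hint Rewrite gmul_assoc_r ginv_mul ginv_inv ginv_one gmul_1l gmul_1r
  gmul_Vl gmul_Vr gmul_Kl gmul_VKl : grp.

Ltac grp := unfold gcomm, gconj; autorewrite with grp; try reflexivity.
Ltac grp_eq x y := replace x with y by grp.

Lemma gcomm_mul_l (G : Group) (x x' y : G) :
  gcomm (gmul x x') y = gmul (gconj (gcomm x y) x') (gcomm x' y).
Proof. grp. Qed.

Lemma gcomm_mul_r (G : Group) (x y y' : G) :
  gcomm x (gmul y y') = gmul (gcomm x y') (gconj (gcomm x y) y').
Proof. grp. Qed.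

Lemma gcomm_inv_l (G : Group) (x y : G) :
  gcomm (ginv x) y = gconj (ginv (gcomm x y)) (ginv x).
Proof. grp. Qed.

Lemma gcomm_inv_r (G : Group) (x y : G) :
  gcomm x (ginv y) = gconj (ginv (gcomm x y)) (ginv y).
Proof. grp. Qed.

Lemma ginv_comm (G : Group) (x y : G) : ginv (gcomm x y) = gcomm y x.
Proof. grp. Qed.

Lemma gconj_comm (G : Group) (x y g : G) :
  gconj (gcomm x y) g = gcomm (gconj x g) (gconj y g).
Proof. grp. Qed.

Lemma gconj_mul (G : Group) (x y g : G) :
  gconj (gmul x y) g = gmul (gconj x g) (gconj y g).
Proof. grp. Qed.

Lemma gconj_inv (G : Group) (x g : G) : gconj (ginv x) g = ginv (gconj x g).
Proof. grp. Qed.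

Lemma gconj_gconj (G : Group) (x g h : G) :
  gconj (gconj x g) h = gconj x (gmul g h).
Proof. grp. Qed.

Lemma gpow_add (G : Group) (x : G) j k :
  gpow x (j + k) = gmul (gpow x j) (gpow x k).
Proof. induction j; simpl; [grp | rewrite IHj; grp]. Qed.

Lemma gpow_mul (G : Group) (x : G) j k : gpow x (j * k) = gpow (gpow x j) k.
Proof.
  induction k; simpl.
  - now rewrite Nat.mul_0_r.
  - now rewrite Nat.mul_succ_r, Nat.add_comm, gpow_add, IHk.
Qed.

Lemma gpow_one (G : Group) k : gpow gone k = (@gone G).
Proof. induction k; simpl; [|rewrite IHk]; grp. Qed.

Lemma gpow_succ_r (G : Group) (x : G) k : gpow x (S k) = gmul (gpow x k) x.
Proof. rewrite <- Nat.add_1_r, gpow_add. simpl. now rewrite gmul_1r. Qed.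

Lemma gpow_ginv (G : Group) (x : G) k : gpow (ginv x) k = ginv (gpow x k).
Proof.
  induction k as [|k IH]; [simpl; grp|].
  rewrite gpow_succ_r, IH. simpl. now rewrite ginv_mul.
Qed.

Lemma gconj_pow (G : Group) (x g : G) k : gconj (gpow x k) g = gpow (gconj x g) k.
Proof. induction k; simpl; [|rewrite <- IHk]; grp. Qed.

Lemma pigeonhole_nat {A : Type} (f : nat -> A) (l : list A) :
  (forall k, In (f k) l) -> exists j k, j < k <= length l /\ f j = f k.
Proof.
  intros H. apply NNPP. intros no.
  assert (nd : NoDup (map f (seq 0 (S (length l))))).
  { apply NoDup_map_NoDup_ForallPairs; [|apply seq_NoDup].
    intros a b Ha Hb E. apply in_seq in Ha, Hb.
    destruct (Nat.lt_trichotomy a b) as [L|[L|L]]; auto; exfalso; apply no.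
    - exists a, b. split; [lia | auto].
    - exists b, a. split; [lia | auto]. }
  apply NoDup_incl_length with (l' := l) in nd.
  - rewrite length_map, length_seq in nd. lia.
  - intros y Hy. apply in_map_iff in Hy as (k & <- & _). apply H.
Qed.

(** Pigeonhole yields a period between 1 and [M] that varies with the element; the factorial turns
    it into a uniform exponent. *)
Lemma divide_fact d M : 0 < d <= M -> Nat.divide d (fact M).
Proof.
  intros [h1 h2]. induction M as [|M IH]; [lia|].
  change (fact (S M)) with (S M * fact M).
  destruct (Nat.eq_dec d (S M)) as [->|ne].
  - apply Nat.divide_factor_l.
  - apply Nat.divide_mul_r, IH. lia.
Qed.

(** * Generated subgroups and commutator subgroups *)

Definition sub {G : Group} (A B : G -> Prop) : Prop := forall x, A x -> B x.

Definition cset {G : Group} (A B : G -> Prop) : G -> Prop :=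
  fun z => exists a b, A a /\ B b /\ z = gcomm a b.

Definition csub {G : Group} (A B : G -> Prop) : G -> Prop := gen (cset A B).

Lemma gen_sub (G : Group) (A D : G -> Prop) :
  normal_subgroup D -> sub A D -> sub (gen A) D.
Proof. intros (d1 & dm & dv & _) H x Hx. induction Hx; auto. Qed.

Lemma gen_mono (G : Group) (A B : G -> Prop) : sub A (gen B) -> sub (gen A) (gen B).
Proof.
  intros H x Hx. induction Hx; auto using @gen_one, @gen_mul, @gen_inv.
Qed.

Lemma gen_normal (G : Group) (A : G -> Prop) :
  normal_subset A -> normal_subgroup (gen A).
Proof.
  intros H. repeat split; auto using @gen_one, @gen_mul, @gen_inv.
  intros x g Hx. induction Hx.
  - apply gen_in, H; auto.
  - grp_eq (gconj (@gone G) g) (@gone G). apply gen_one.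
  - rewrite gconj_mul. now apply gen_mul.
  - rewrite gconj_inv. now apply gen_inv.
Qed.

Lemma normal_subgroup_subset (G : Group) (A : G -> Prop) :
  normal_subgroup A -> normal_subset A.
Proof. intros (_ & _ & _ & H). exact H. Qed.

Lemma gen_normal_subset (G : Group) (A : G -> Prop) :
  normal_subset A -> normal_subset (gen A).
Proof. intros H. now apply normal_subgroup_subset, gen_normal. Qed.

Lemma gpow_gen (G : Group) (A : G -> Prop) x k : gen A x -> gen A (gpow x k).
Proof. intros H. induction k; simpl; auto using @gen_one, @gen_mul. Qed.

Lemma gpow_normal (G : Group) (A : G -> Prop) x k :
  normal_subgroup A -> A x -> A (gpow x k).
Proof. intros (a1 & am & _) H. induction k; simpl; auto. Qed.

Lemma cset_normal (G : Group) (A B : G -> Prop) :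
  normal_subset A -> normal_subset B -> normal_subset (cset A B).
Proof.
  intros hA hB x g (a & b & Ha & Hb & ->). rewrite gconj_comm.
  exists (gconj a g), (gconj b g). auto.
Qed.

Lemma csub_normal (G : Group) (A B : G -> Prop) :
  normal_subset A -> normal_subset B -> normal_subgroup (csub A B).
Proof. intros. now apply gen_normal, cset_normal. Qed.

Lemma csub_in (G : Group) (A B : G -> Prop) a b : A a -> B b -> csub A B (gcomm a b).
Proof. intros. apply gen_in. exists a, b. auto. Qed.

Lemma csub_mono (G : Group) (A A' B B' : G -> Prop) :
  sub A A' -> sub B B' -> sub (csub A B) (csub A' B').
Proof.
  intros hA hB. apply gen_mono. intros x (a & b & Ha & Hb & ->).
  apply csub_in; auto.
Qed.

Lemma csub_sym (G : Group) (A B : G -> Prop) : sub (csub A B) (csub B A).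
Proof.
  apply gen_mono. intros x (a & b & Ha & Hb & ->). rewrite <- ginv_comm.
  apply gen_inv, csub_in; auto.
Qed.

Lemma csub_sub (G : Group) (A B D : G -> Prop) :
  normal_subgroup D -> (forall a b, A a -> B b -> D (gcomm a b)) -> sub (csub A B) D.
Proof.
  intros hD H. apply gen_sub; auto. intros x (a & b & Ha & Hb & ->). auto.
Qed.

Lemma csub_sub_l (G : Group) (A B : G -> Prop) : normal_subgroup A -> sub (csub A B) A.
Proof.
  intros hA. apply csub_sub; auto. intros a b Ha _.
  grp_eq (gcomm a b) (gmul (ginv a) (gconj a b)).
  destruct hA as (h1 & hm & hv & hc). auto.
Qed.

Lemma csub_sub_r (G : Group) (A B : G -> Prop) : normal_subgroup B -> sub (csub A B) B.
Proof. intros hB x Hx. apply csub_sym in Hx. revert x Hx. now apply csub_sub_l. Qed.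

(** Expanding a product or an inverse in one argument gives products of conjugates of commutators
    already treated or of their inverses, all absorbed by the normal [D]. *)
Lemma gcomm_gen_sub (G : Group) (A B D : G -> Prop) :
  normal_subgroup D -> (forall a b, A a -> B b -> D (gcomm a b)) ->
  forall a b, gen A a -> gen B b -> D (gcomm a b).
Proof.
  intros (d1 & dm & dv & dc) H.
  assert (H1 : forall a b, gen A a -> B b -> D (gcomm a b)).
  { intros a b Ha Hb. induction Ha; auto.
    - grp_eq (gcomm gone b) (@gone G). auto.
    - rewrite gcomm_mul_l. auto.
    - rewrite gcomm_inv_l. auto. }
  intros a b Ha Hb. induction Hb; auto.
  - grp_eq (gcomm a gone) (@gone G). auto.
  - rewrite gcomm_mul_r. auto.
  - rewrite gcomm_inv_r. auto.
Qed.

Lemma csub_gen (G : Group) (A B : G -> Prop) :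
  normal_subset A -> normal_subset B -> sub (csub (gen A) (gen B)) (csub A B).
Proof.
  intros hA hB. apply csub_sub; [now apply csub_normal|].
  apply gcomm_gen_sub; [now apply csub_normal|]. intros; now apply csub_in.
Qed.

(** * Congruence modulo a normal subgroup, in place of quotient groups *)

Definition cong {G : Group} (K : G -> Prop) (x y : G) : Prop := K (gmul (ginv x) y).

Lemma cong_refl (G : Group) (K : G -> Prop) x : normal_subgroup K -> cong K x x.
Proof. intros (h & _). unfold cong. now rewrite gmul_Vl. Qed.

Lemma cong_sym (G : Group) (K : G -> Prop) x y :
  normal_subgroup K -> cong K x y -> cong K y x.
Proof.
  unfold cong. intros (_ & _ & hv & _) H.
  grp_eq (gmul (ginv y) x) (ginv (gmul (ginv x) y)). auto.
Qed.

Lemma cong_trans (G : Group) (K : G -> Prop) x y z :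
  normal_subgroup K -> cong K x y -> cong K y z -> cong K x z.
Proof.
  unfold cong. intros (_ & hm & _) H1 H2.
  grp_eq (gmul (ginv x) z) (gmul (gmul (ginv x) y) (gmul (ginv y) z)). auto.
Qed.

Lemma cong_mul (G : Group) (K : G -> Prop) x x' y y' :
  normal_subgroup K -> cong K x x' -> cong K y y' -> cong K (gmul x y) (gmul x' y').
Proof.
  unfold cong. intros (_ & hm & _ & hc) H1 H2.
  grp_eq (gmul (ginv (gmul x y)) (gmul x' y'))
    (gmul (gconj (gmul (ginv x) x') y) (gmul (ginv y) y')). auto.
Qed.

Lemma cong_pow (G : Group) (K : G -> Prop) x y k :
  normal_subgroup K -> cong K x y -> cong K (gpow x k) (gpow y k).
Proof.
  intros hK H. induction k; simpl; [now apply cong_refl | now apply cong_mul].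
Qed.

Lemma cong_mem (G : Group) (K : G -> Prop) x y :
  normal_subgroup K -> cong K x y -> K x -> K y.
Proof.
  intros (_ & hm & _) H Hx. grp_eq y (gmul x (gmul (ginv x) y)). auto.
Qed.

Lemma cong_mul_r (G : Group) (K : G -> Prop) x k :
  normal_subgroup K -> K k -> cong K (gmul x k) x.
Proof.
  intros hK Hk. apply cong_sym; auto. unfold cong.
  now rewrite gmul_VKl.
Qed.

Lemma cong_comm (G : Group) (K : G -> Prop) x y :
  normal_subgroup K -> K (gcomm x y) -> cong K (gmul y x) (gmul x y).
Proof.
  intros hK H. unfold cong.
  now grp_eq (gmul (ginv (gmul y x)) (gmul x y)) (gcomm x y).
Qed.

Lemma pow_mul_mod (G : Group) (K : G -> Prop) x y k :
  normal_subgroup K -> K (gcomm x y) ->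
  cong K (gpow (gmul x y) k) (gmul (gpow x k) (gpow y k)).
Proof.
  intros hK H.
  assert (Hc : forall j, K (gcomm (gpow x j) y)).
  { intros j. apply (gcomm_gen_sub G (eq x) (eq y)); auto.
    - intros a b <- <-. auto.
    - now apply gpow_gen, gen_in.
    - now apply gen_in. }
  induction k as [|k IH]; simpl; [rewrite gmul_1l; now apply cong_refl|].
  apply cong_trans with (gmul (gmul x y) (gmul (gpow x k) (gpow y k))); auto.
  - apply cong_mul; auto. now apply cong_refl.
  - grp_eq (gmul (gmul x y) (gmul (gpow x k) (gpow y k)))
      (gmul x (gmul (gmul y (gpow x k)) (gpow y k))).
    grp_eq (gmul (gmul x (gpow x k)) (gmul y (gpow y k)))
      (gmul x (gmul (gmul (gpow x k) y) (gpow y k))).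
    apply cong_mul; auto; [now apply cong_refl|].
    apply cong_mul; auto; [|now apply cong_refl]. apply cong_comm; auto.
Qed.

(** * Left-normed commutators with entries in normal subsets *)

Fixpoint lcomm {G : Group} (x : G) (ys : list G) : G :=
  match ys with [] => x | y :: ys' => lcomm (gcomm x y) ys' end.

(** The entries are kept as sets, because finiteness of the values concerns the sets; [lcsub_gen]
    recovers this subgroup from commutators with entries in them. *)
Fixpoint lcsub {G : Group} (X : G -> Prop) (Rs : list (G -> Prop)) : G -> Prop :=
  match Rs with [] => X | R :: Rs' => lcsub (csub X (gen R)) Rs' end.

Definition members {G : Group} : list G -> list (G -> Prop) -> Prop :=
  Forall2 (fun y R => R y).

(** In [xx', y] = [x, y] [[x, y], x'] [x', y] the middle factor is the obstruction; the second
    conjunct kills its image under the remaining entries, and the first treats those entries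
    recursively. The base case makes the final commutator subgroup abelian modulo [K]. *)
Fixpoint multiplicative_mod {G : Group} (X : G -> Prop) (Rs : list (G -> Prop))
    (K : G -> Prop) : Prop :=
  match Rs with
  | [] => sub (csub X X) K
  | R :: Rs' =>
      multiplicative_mod (csub X (gen R)) Rs' K /\
      sub (lcsub (csub (csub X (gen R)) X) Rs') K
  end.

Lemma lcomm_app (G : Group) (x : G) ys zs :
  lcomm x (ys ++ zs) = lcomm (lcomm x ys) zs.
Proof. revert x. induction ys; simpl; auto. Qed.

(** Conjugations that arise are pushed into the entries, which stay in their normal sets. Here and
    in [lcomm_mul] the equality is exact, so that values can be counted without a modulus. *)
Lemma lcomm_inv (G : Group) (Rs : list (G -> Prop)) x ys :
  Forall normal_subset Rs -> members ys Rs ->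
  exists ys', members ys' Rs /\ lcomm (ginv x) ys = ginv (lcomm x ys').
Proof.
  intros hR H. revert x. induction H as [|y R ys Rs Hy H IH]; intros x.
  - exists []. split; [constructor | reflexivity].
  - inversion hR as [|? ? hR1 hR2]; subst. simpl.
    destruct (IH hR2 (gcomm x (gconj y (ginv x)))) as (ys' & H' & E).
    exists (gconj y (ginv x) :: ys'). split; [constructor; auto|].
    simpl. rewrite <- E. f_equal. grp.
Qed.

Lemma lcomm_mul (G : Group) (Rs : list (G -> Prop)) x x' ys :
  Forall normal_subset Rs -> members ys Rs ->
  exists g ys', members ys' Rs /\
    lcomm (gmul x x') ys = gmul (lcomm (gconj x g) ys') (lcomm x' ys).
Proof.
  intros hR H. revert x x'. induction H as [|y R ys Rs Hy H IH]; intros x x'.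
  - exists gone, []. split; [constructor | simpl; grp].
  - inversion hR as [|? ? hR1 hR2]; subst. simpl.
    destruct (IH hR2 (gconj (gcomm x y) x') (gcomm x' y)) as (g & ys' & H' & E).
    exists (gmul x' g), (gconj y (gmul x' g) :: ys'). split; [constructor; auto|].
    rewrite gcomm_mul_l, E. simpl. do 2 f_equal. grp.
Qed.

Lemma lcsub_mono (G : Group) (X X' : G -> Prop) Rs Rs' :
  sub X X' -> Forall2 (fun R R' => sub (gen R) (gen R')) Rs Rs' ->
  sub (lcsub X Rs) (lcsub X' Rs').
Proof.
  intros hX H. revert X X' hX. induction H; intros X X' hX; simpl; auto.
  apply IHForall2, csub_mono; auto.
Qed.

Lemma sub_refl_Forall2 (G : Group) (Rs : list (G -> Prop)) :
  Forall2 (fun R R' => sub (gen R) (gen R')) Rs Rs.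
Proof. induction Rs; constructor; unfold sub; auto. Qed.

Lemma lcsub_mono_l (G : Group) (X X' : G -> Prop) Rs :
  sub X X' -> sub (lcsub X Rs) (lcsub X' Rs).
Proof. intros. apply lcsub_mono; auto. apply sub_refl_Forall2. Qed.

Lemma lcsub_normal (G : Group) (X : G -> Prop) Rs :
  normal_subgroup X -> Forall normal_subset Rs -> normal_subgroup (lcsub X Rs).
Proof.
  intros hX H. revert X hX. induction H; intros X hX; simpl; auto.
  apply IHForall, csub_normal; [now apply normal_subgroup_subset|].
  now apply gen_normal_subset.
Qed.

Lemma lcsub_app (G : Group) (X : G -> Prop) Ls Rs :
  lcsub X (Ls ++ Rs) = lcsub (lcsub X Ls) Rs.
Proof. revert X. induction Ls; simpl; auto. Qed.

Lemma lcsub_sub (G : Group) (X : G -> Prop) Rs :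
  normal_subgroup X -> Forall normal_subset Rs -> sub (lcsub X Rs) X.
Proof.
  intros hX H. revert X hX. induction H as [|R Rs hR H IH]; intros X hX x Hx; simpl in *; auto.
  apply (csub_sub_l _ _ (gen R)); auto. apply IH; auto.
  apply csub_normal; [now apply normal_subgroup_subset | now apply gen_normal_subset].
Qed.

Lemma lcsub_gen (G : Group) (X : G -> Prop) Rs :
  normal_subset X -> Forall normal_subset Rs ->
  sub (lcsub (gen X) Rs)
    (gen (fun z => exists x ys, X x /\ members ys Rs /\ z = lcomm x ys)).
Proof.
  intros hX H. revert X hX. induction H as [|R Rs hR H IH]; intros X hX z Hz; simpl in *.
  - revert z Hz. apply gen_mono. intros x Hx. apply gen_in.
    exists x, []. repeat split; auto. constructor.
  - apply (lcsub_mono_l _ _ (gen (cset X R))) in Hz; [|now apply csub_gen].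
    apply IH in Hz; [|now apply cset_normal].
    revert z Hz. apply gen_mono. intros z (x & ys & (a & b & Ha & Hb & ->) & Hy & ->).
    apply gen_in. exists a, (b :: ys). repeat split; auto. now constructor.
Qed.

Lemma lcomm_in (G : Group) (X : G -> Prop) Rs x ys :
  X x -> members ys Rs -> lcsub X Rs (lcomm x ys).
Proof.
  intros Hx H. revert X x Hx. induction H; intros X z Hz; simpl; auto.
  apply IHForall2, csub_in; auto. now apply gen_in.
Qed.

(** * Multiplicativity modulo [K] and its consequences *)

Lemma multiplicative_mod_antitone (G : Group) (X X' : G -> Prop) Rs K K' :
  sub X' X -> sub K K' -> multiplicative_mod X Rs K -> multiplicative_mod X' Rs K'.
Proof.
  intros hX hK. revert X X' hX. induction Rs as [|R Rs IH]; simpl; intros X X' hX H.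
  - intros x Hx. apply hK, H. revert x Hx. now apply csub_mono.
  - destruct H as [H1 H2].
    assert (h : sub (csub X' (gen R)) (csub X (gen R))) by (apply csub_mono; unfold sub; auto).
    split; [now apply (IH _ _ h)|].
    intros x Hx. apply hK, H2. revert x Hx. apply lcsub_mono_l. now apply csub_mono.
Qed.

(* [[X, X], Y] <= [[X, Y], X]: modulo the right-hand side conjugation by y
   changes each argument of [a, b] by an element commuting with X. *)
Lemma three_subgroups (G : Group) (X Y : G -> Prop) :
  normal_subgroup X -> normal_subgroup Y ->
  sub (csub (csub X X) Y) (csub (csub X Y) X).
Proof.
  intros hX hY.
  assert (nX := normal_subgroup_subset _ _ hX).
  assert (nY := normal_subgroup_subset _ _ hY).
  assert (hXY : normal_subgroup (csub X Y)) by now apply csub_normal.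
  set (D := csub (csub X Y) X).
  assert (hD : normal_subgroup D).
  { apply csub_normal; auto. now apply normal_subgroup_subset. }
  assert (HD : forall c a, csub X Y c -> X a -> D (gcomm c a)).
  { intros. now apply csub_in. }
  destruct hX as (x1 & xm & xv & xc). destruct hD as (d1 & dm & dv & dc).
  apply csub_sub; [repeat split; auto|].
  intros z y Hz Hy.
  apply (gcomm_gen_sub G (cset X X) Y); [repeat split; auto| | auto | now apply gen_in].
  clear z y Hz Hy. intros z y (a & b & Ha & Hb & ->) Hy.
  set (c := gcomm a y). set (d := gcomm b y).
  assert (Hc : csub X Y c) by now apply csub_in.
  assert (Hd : csub X Y d) by now apply csub_in.
  assert (Hd' : X d).
  { revert Hd. apply csub_sub_l. repeat split; auto. }
  assert (Hc' : X c).
  { revert Hc. apply csub_sub_l. repeat split; auto. }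
  assert (Hab : X (gcomm a b)).
  { grp_eq (gcomm a b) (gmul (ginv a) (gconj a b)). auto. }
  (* As a^y = ac and b^y = bd, the left side is [a, b]^-1 [ac, bd]. The expansion isolates a
     conjugate of [d, ac]^-1, then [cd, [a, b]]^-1, then a conjugate of [c, b], each in [D]. *)
  assert (E : gcomm (gcomm a b) y =
    gmul (gmul (ginv (gcomm a b)) (gmul (ginv (gcomm d (gmul a c))) (gcomm a b)))
     (gmul (ginv (gcomm (gmul c d) (gcomm a b))) (gconj (gcomm c b) d))).
  { unfold c, d. grp. }
  rewrite E. apply dm; [|apply dm].
  - apply (dc (ginv (gcomm d (gmul a c))) (gcomm a b)). auto.
  - apply dv, HD; auto. now apply hXY.
  - auto.
Qed.

Lemma lcsub_derived (G : Group) (X : G -> Prop) Rs K :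
  normal_subgroup X -> Forall normal_subset Rs ->
  multiplicative_mod X Rs K -> sub (lcsub (csub X X) Rs) K.
Proof.
  intros hX H. destruct H as [|R Rs hR H]; simpl; auto.
  intros [_ H2] x Hx. apply H2. revert x Hx. apply lcsub_mono_l.
  apply three_subgroups; auto. now apply gen_normal.
Qed.

(** The obstruction for an entry from [Ls] lies in [X, X]. Further entries of [Ls] keep it there,
    and [Rs] then sends it into [K] by [lcsub_derived]. This is how multiplicativity passes to
    longer contexts. *)
Lemma multiplicative_mod_app (G : Group) (X X' : G -> Prop) Ls Rs K :
  normal_subgroup X -> normal_subgroup X' -> sub X' X ->
  Forall normal_subset Ls -> Forall normal_subset Rs ->
  multiplicative_mod X Rs K -> multiplicative_mod X' (Ls ++ Rs) K.
Proof.
  intros hX hX' sX hL hR H. revert X' hX' sX.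
  assert (HD := lcsub_derived _ _ _ _ hX hR H).
  induction hL as [|L Ls hL hLs IH]; intros X' hX' sX; simpl.
  - revert H. apply multiplicative_mod_antitone; unfold sub; auto.
  - assert (nX := normal_subgroup_subset _ _ hX').
    assert (nL := gen_normal_subset _ _ hL).
    assert (n1 : normal_subgroup (csub X' (gen L))) by now apply csub_normal.
    assert (s1 : sub (csub X' (gen L)) X).
    { intros x Hx. apply sX. revert x Hx. now apply csub_sub_l. }
    split; [now apply IH|].
    intros x Hx. apply HD. rewrite lcsub_app in Hx. revert x Hx.
    apply lcsub_mono_l. intros x Hx. apply lcsub_sub in Hx; auto.
    + revert x Hx. now apply csub_mono.
    + apply csub_normal; auto. now apply normal_subgroup_subset.
Qed.

Lemma multiplicative_mod_abelian (G : Group) (X : G -> Prop) Rs K :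
  multiplicative_mod X Rs K -> sub (csub (lcsub X Rs) (lcsub X Rs)) K.
Proof. revert X. induction Rs; simpl; intros X H; auto. now apply IHRs. Qed.

Lemma lcomm_mul_mod (G : Group) (X : G -> Prop) Rs K x x' ys :
  normal_subgroup X -> normal_subgroup K -> Forall normal_subset Rs ->
  multiplicative_mod X Rs K -> X x -> X x' -> members ys Rs ->
  cong K (lcomm (gmul x x') ys) (gmul (lcomm x ys) (lcomm x' ys)).
Proof.
  intros hX hK hR H Hx Hx' Hy. revert X x x' hX H Hx Hx'.
  induction Hy as [|y R ys Rs Hy Hys IH]; intros X x x' hX H Hx Hx'; simpl.
  - now apply cong_refl.
  - inversion hR as [|? ? hR1 hR2]; subst. simpl in H. destruct H as [H1 H2].
    assert (nX := normal_subgroup_subset _ _ hX).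
    assert (n1 : normal_subgroup (csub X (gen R))).
    { apply csub_normal; auto. now apply gen_normal_subset. }
    assert (Hg : gen R y) by now apply gen_in.
    assert (Ha : csub X (gen R) (gcomm x y)) by now apply csub_in.
    assert (Hb : csub X (gen R) (gcomm x' y)) by now apply csub_in.
    assert (He : csub (csub X (gen R)) X (gcomm (gcomm x y) x')) by now apply csub_in.
    assert (He' : csub X (gen R) (gcomm (gcomm x y) x')).
    { revert He. now apply csub_sub_l. }
    grp_eq (gcomm (gmul x x') y)
      (gmul (gcomm x y) (gmul (gcomm (gcomm x y) x') (gcomm x' y))).
    eapply cong_trans; auto; [apply (IH hR2 (csub X (gen R))); auto|].
    { now apply n1. }
    apply cong_mul; auto; [now apply cong_refl|].
    eapply cong_trans; auto; [apply (IH hR2 (csub X (gen R))); auto|].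
    apply cong_sym; auto. unfold cong.
    match goal with |- K (gmul (ginv ?b) (gmul ?e ?b)) => change (K (gconj e b)) end.
    apply hK, H2. now apply lcomm_in.
Qed.

Lemma lcomm_one (G : Group) ys : lcomm gone ys = @gone G.
Proof.
  induction ys as [|y ys IH]; simpl; auto.
  now grp_eq (gcomm gone y) (@gone G).
Qed.

Lemma lcomm_pow_mod (G : Group) (X : G -> Prop) Rs K x ys k :
  normal_subgroup X -> normal_subgroup K -> Forall normal_subset Rs ->
  multiplicative_mod X Rs K -> X x -> members ys Rs ->
  cong K (lcomm (gpow x k) ys) (gpow (lcomm x ys) k).
Proof.
  intros hX hK hR H Hx Hy. induction k; simpl.
  - rewrite lcomm_one. now apply cong_refl.
  - eapply cong_trans; auto.
    + apply (lcomm_mul_mod _ X Rs); auto. now apply gpow_normal.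
    + apply cong_mul; auto. now apply cong_refl.
Qed.

(** Modulo [K] the group is abelian, so the [E]-th power map is a homomorphism. *)
Lemma exponent_gen (G : Group) (A K : G -> Prop) E :
  normal_subgroup K -> sub (csub (gen A) (gen A)) K ->
  (forall x, A x -> K (gpow x E)) -> forall x, gen A x -> K (gpow x E).
Proof.
  intros hK hA H x Hx. induction Hx as [x Hx| |x y Hx IHx Hy IHy|x Hx IHx]; auto.
  - rewrite gpow_one. apply hK.
  - eapply cong_mem; auto.
    + apply cong_sym; auto. apply pow_mul_mod; auto. apply hA. now apply csub_in.
    + now apply hK.
  - rewrite gpow_ginv. now apply hK.
Qed.

(* Among the M+1 values of lcomm at x^0, x^n, ..., x^(nM) two agree. *)
Lemma exponent_of_finite_values (G : Group) (X K : G -> Prop) Rs n (P : list G) :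
  normal_subgroup X -> normal_subgroup K -> Forall normal_subset Rs ->
  multiplicative_mod X Rs K ->
  (forall x ys k, X x -> members ys Rs -> In (lcomm (gpow x (n * k)) ys) P) ->
  forall z, lcsub X Rs z -> K (gpow z (n * fact (length P))).
Proof.
  intros hX hK hR H HP z Hz.
  apply (lcsub_mono_l _ _ (gen X)) in Hz; [|intros u Hu; now apply gen_in].
  apply lcsub_gen in Hz; auto; [|now apply normal_subgroup_subset].
  set (A := fun z => _) in Hz.
  assert (hA : sub (gen A) (lcsub X Rs)).
  { apply gen_sub; [now apply lcsub_normal|].
    intros u (x & ys & Hx & Hys & ->). now apply lcomm_in. }
  revert z Hz. apply exponent_gen; auto.
  - intros u Hu. apply (multiplicative_mod_abelian _ X Rs); auto.
    revert u Hu. now apply csub_mono.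
  - intros u (x & ys & Hx & Hys & ->).
    destruct (pigeonhole_nat (fun k => lcomm (gpow x (n * k)) ys) P) as (j & k & Hjk & E).
    { intros k. now apply HP. }
    set (v := lcomm x ys).
    assert (C : cong K (gpow v (n * j)) (gpow v (n * k))).
    { apply cong_trans with (lcomm (gpow x (n * j)) ys); auto.
      - apply cong_sym; auto. now apply (lcomm_pow_mod _ X Rs).
      - rewrite E. now apply (lcomm_pow_mod _ X Rs). }
    assert (Kd : K (gpow v (n * (k - j)))).
    { replace (n * k) with (n * j + n * (k - j)) in C by nia.
      unfold cong in C. now rewrite gpow_add, gmul_VKl in C. }
    destruct (divide_fact (k - j) (length P)) as [q Eq]; [lia|].
    rewrite Eq. replace (n * (q * (k - j))) with (n * (k - j) * q) by lia.
    rewrite gpow_mul. now apply gpow_normal.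
Qed.

Definition setmul {G : Group} (A K : G -> Prop) : G -> Prop :=
  fun z => exists a k, A a /\ K k /\ z = gmul a k.

Lemma setmul_normal (G : Group) (A K : G -> Prop) :
  normal_subgroup A -> normal_subgroup K -> normal_subgroup (setmul A K).
Proof.
  intros (a1 & am & av & ac) (k1 & km & kv & kc). repeat split.
  - exists gone, gone. repeat split; auto. grp.
  - intros x y (a & k & Ha & Hk & ->) (b & l & Hb & Hl & ->).
    exists (gmul a b), (gmul (gconj k b) l). repeat split; auto. grp.
  - intros x (a & k & Ha & Hk & ->).
    exists (ginv a), (gconj (ginv k) (ginv a)). repeat split; auto. grp.
  - intros x g (a & k & Ha & Hk & ->).
    exists (gconj a g), (gconj k g). repeat split; auto. grp.
Qed.

Lemma setmul_l (G : Group) (A K : G -> Prop) : normal_subgroup K -> sub A (setmul A K).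
Proof. intros (k1 & _) x Hx. exists x, gone. repeat split; auto. grp. Qed.

Lemma setmul_r (G : Group) (A K : G -> Prop) : normal_subgroup A -> sub K (setmul A K).
Proof. intros (k1 & _) x Hx. exists gone, x. repeat split; auto. grp. Qed.

Lemma setmul_exponent (G : Group) (A K K' : G -> Prop) E :
  normal_subgroup K' -> sub K K' -> (forall a, A a -> K' (gpow a E)) ->
  forall z, setmul A K z -> K' (gpow z E).
Proof.
  intros hK' hK H z (a & k & Ha & Hk & ->).
  apply cong_mem with (gpow a E); auto.
  apply cong_pow; auto. apply cong_sym; auto. apply cong_mul_r; auto.
Qed.

(** * The exponent of an outer commutator subgroup *)

(** Both sides of a commutator are chosen independently, which suits induction on the word; for
    distinct variables this is w{S}. *)
Fixpoint vals {G : Group} (S : nat -> G -> Prop) (w : ocword) : G -> Prop :=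
  match w with OVar i => S i | OComm a b => cset (vals S a) (vals S b) end.

(** Writes w as [...[[x_i, b_1], b_2], ..., b_d] with i = [left_var w]; the list is b_1, ...,
    b_d. *)
Fixpoint left_spine (w : ocword) : list ocword :=
  match w with OVar _ => [] | OComm a b => left_spine a ++ [b] end.

Fixpoint left_var (w : ocword) : nat :=
  match w with OVar i => i | OComm a _ => left_var a end.

Lemma left_var_in (w : ocword) : In (left_var w) (ocvars w).
Proof. induction w; simpl; [auto | apply in_or_app; auto]. Qed.

Lemma vals_normal (G : Group) (S : nat -> G -> Prop) w :
  (forall i, In i (ocvars w) -> normal_subset (S i)) -> normal_subset (vals S w).
Proof.
  induction w as [i|a IHa b IHb]; simpl; intros H; auto.
  apply cset_normal; [apply IHa | apply IHb]; intros; apply H, in_or_app; auto.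
Qed.

Lemma left_spine_normal (G : Group) (S : nat -> G -> Prop) w :
  (forall i, In i (ocvars w) -> normal_subset (S i)) ->
  Forall normal_subset (map (vals S) (left_spine w)).
Proof.
  induction w as [i|a IHa b IHb]; simpl; intros H; [constructor|].
  rewrite map_app. apply Forall_app. split.
  - apply IHa. intros; apply H, in_or_app; auto.
  - constructor; [|constructor]. apply vals_normal. intros; apply H, in_or_app; auto.
Qed.

Lemma vals_left_spine (G : Group) (S : nat -> G -> Prop) w x ys :
  S (left_var w) x -> members ys (map (vals S) (left_spine w)) -> vals S w (lcomm x ys).
Proof.
  revert ys. induction w as [i|a IHa b IHb]; simpl; intros ys Hx Hy.
  - inversion Hy; subst. exact Hx.
  - rewrite map_app in Hy. apply Forall2_app_inv_r in Hy as (zs & us & Hz & Hu & ->).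
    inversion Hu as [|u ? ? ? Hu1 Hu2]; subst. inversion Hu2; subst.
    rewrite lcomm_app. simpl. exists (lcomm x zs), u. auto.
Qed.

Lemma gen_vals_comm (G : Group) (S : nat -> G -> Prop) a b :
  normal_subset (vals S a) -> normal_subset (vals S b) ->
  sub (gen (vals S (OComm a b))) (csub (gen (vals S a)) (gen (vals S b))) /\
  sub (csub (gen (vals S a)) (gen (vals S b))) (gen (vals S (OComm a b))).
Proof.
  intros ha hb. split; [|now apply csub_gen].
  apply csub_mono; intros x Hx; now apply gen_in.
Qed.

Lemma gen_vals_left_var (G : Group) (S : nat -> G -> Prop) w :
  (forall i, In i (ocvars w) -> normal_subset (S i)) ->
  sub (gen (vals S w)) (gen (S (left_var w))).
Proof.
  induction w as [i|a IHa b IHb]; simpl; intros H x Hx; auto.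
  assert (Ha : forall i, In i (ocvars a) -> normal_subset (S i)).
  { intros; apply H, in_or_app; auto. }
  assert (Hb : forall i, In i (ocvars b) -> normal_subset (S i)).
  { intros; apply H, in_or_app; auto. }
  apply IHa; auto. apply gen_vals_comm in Hx; auto using vals_normal.
  apply csub_sub_l in Hx; auto using gen_normal, vals_normal.
Qed.

Lemma gen_vals_left_spine (G : Group) (S : nat -> G -> Prop) w u :
  (forall i, In i (ocvars w) -> normal_subset (S i)) ->
  In u (left_spine w) -> sub (gen (vals S w)) (gen (vals S u)).
Proof.
  induction w as [i|a IHa b IHb]; intros H Hu x Hx; [destruct Hu|].
  simpl in H, Hu.
  assert (Ha : forall i, In i (ocvars a) -> normal_subset (S i)).
  { intros; apply H, in_or_app; auto. }
  assert (Hb : forall i, In i (ocvars b) -> normal_subset (S i)).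
  { intros; apply H, in_or_app; auto. }
  apply gen_vals_comm in Hx; auto using vals_normal.
  apply in_app_or in Hu as [Hu|[<-|[]]].
  - apply IHa; auto. apply csub_sub_l in Hx; auto using gen_normal, vals_normal.
  - apply csub_sub_r in Hx; auto using gen_normal, vals_normal.
Qed.

(** This is M^(2^s), the number of candidate values after [s] extra entries. *)
Definition iter_square (s M : nat) : nat := Nat.iter s (fun k => k * k) M.

(* [x, z] = x^-1 x^z turns each extra entry of a left-normed commutator into a
   quotient of two values without that entry. *)
Lemma finite_values_app (G : Group) (A : G -> Prop) Ls Rs (P : list G) :
  normal_subset A -> Forall normal_subset Ls -> Forall normal_subset Rs ->
  (forall x ys, A x -> members ys Rs -> In (lcomm x ys) P) ->
  exists P', length P' = iter_square (length Ls) (length P) /\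
    forall x zs, A x -> members zs (Ls ++ Rs) -> In (lcomm x zs) P'.
Proof.
  intros hA hL hR. revert A P hA.
  induction hL as [|L Ls hL hLs IH]; intros A P hA HP.
  - exists P. auto.
  - destruct (IH (cset A L)
      (map (fun p => gmul (ginv (fst p)) (snd p)) (list_prod P P)))
      as (P' & E & HP').
    + now apply cset_normal.
    + intros x ys (a & z & Ha & Hz & ->) Hy.
      grp_eq (gcomm a z) (gmul (ginv a) (gconj a z)).
      destruct (lcomm_mul _ Rs (ginv a) (gconj a z) ys hR Hy) as (g & ys' & Hy' & ->).
      rewrite gconj_inv.
      destruct (lcomm_inv _ Rs (gconj a g) ys' hR Hy') as (ys2 & Hy2 & ->).
      apply in_map_iff. refine (ex_intro _ (_, _) (conj eq_refl _)).
      apply in_prod; apply HP; auto.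
    + exists P'. split.
      * rewrite E, length_map, length_prod. simpl length. unfold iter_square.
        now rewrite Nat.iter_succ_r.
      * intros x zs Hx Hz. inversion Hz as [|z ? zs' ? Hz1 Hz2]; subst. simpl.
        apply HP'; auto. exists x, z. auto.
Qed.

Fixpoint nprod (f : nat -> nat) (s : nat) : nat :=
  match s with 0 => 1 | S s' => nprod f s' * f s' end.

(** [M] is the number of values in the current context. For [a, b] the factors are the costs of
    passing from W to [W, V2], of adding V1 once for each entry of the left spine of [a], and of the
    final pigeonhole on the leftmost variable of [a]. *)
Fixpoint oc_exponent (w : ocword) (n : nat -> nat) (M : nat) : nat :=
  match w with
  | OVar i => n i * fact M
  | OComm a b =>
      oc_exponent b n M *
      nprod (fun s => oc_exponent a n (iter_square (S s) M)) (length (left_spine a)) *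
      (n (left_var a) * fact M)
  end.

Lemma oc_exponent_pos w n M :
  (forall i, In i (ocvars w) -> 0 < n i) -> 0 < oc_exponent w n M.
Proof.
  revert M. induction w as [i|a IHa b IHb]; intros M H; simpl in *.
  - apply Nat.mul_pos_pos; [auto | apply lt_O_fact].
  - assert (Ha : forall M, 0 < oc_exponent a n M).
    { intros. apply IHa. intros; apply H, in_or_app; auto. }
    repeat apply Nat.mul_pos_pos.
    + apply IHb. intros; apply H, in_or_app; auto.
    + generalize (length (left_spine a)). intros l. induction l; simpl; [lia|].
      now apply Nat.mul_pos_pos.
    + apply H, in_or_app. left. apply left_var_in.
    + apply lt_O_fact.
Qed.

(* Write W = [V1, V2] for the values of w = [a, b], and [W, k V1, V2] for
   [W, V1, ..., V1, V2].  Being linear in the V2-argument modulo [W, V2], and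
   in the V1-argument of [V1, V2, k V1, V2] modulo [W, (k+1) V1, V2], W is
   pushed by induction into [W, d V1, V2], d the length of the left spine of a.
   Since V1 lies in every subgroup on that spine, this is contained in the
   subgroup obtained by substituting W for the leftmost variable of w, where w
   is linear. *)
Lemma oc_exponent_spec (w : ocword) (n : nat -> nat) (G : Group)
    (U : nat -> G -> Prop) (Rs : list (G -> Prop)) (K : G -> Prop) (P : list G) :
  (forall i, In i (ocvars w) -> normal_subset (U i)) ->
  (forall i, In i (ocvars w) -> forall x, gen (U i) x -> U i (gpow x (n i))) ->
  Forall normal_subset Rs -> normal_subgroup K ->
  (forall x ys, vals U w x -> members ys Rs -> In (lcomm x ys) P) ->
  multiplicative_mod (gen (vals U w)) Rs K ->
  forall z, lcsub (gen (vals U w)) Rs z -> K (gpow z (oc_exponent w n (length P))).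
Proof.
  revert Rs K P. induction w as [i|a IHa b IHb]; intros Rs K P hS hn hR hK HP HL.
  - simpl in *. apply exponent_of_finite_values; auto.
    + apply gen_normal. auto.
    + intros x ys k Hx Hy. apply HP; auto. rewrite Nat.mul_comm, gpow_mul.
      apply hn; auto. now apply gpow_gen.
  - assert (hSa : forall i, In i (ocvars a) -> normal_subset (U i)).
    { intros. apply hS. simpl. apply in_or_app; auto. }
    assert (hSb : forall i, In i (ocvars b) -> normal_subset (U i)).
    { intros. apply hS. simpl. apply in_or_app; auto. }
    assert (hna : forall i, In i (ocvars a) -> forall x, gen (U i) x -> U i (gpow x (n i))).
    { intros. apply hn; auto. simpl. apply in_or_app; auto. }
    assert (hnb : forall i, In i (ocvars b) -> forall x, gen (U i) x -> U i (gpow x (n i))).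
    { intros. apply hn; auto. simpl. apply in_or_app; auto. }
    specialize (fun Rs K P => IHa Rs K P hSa hna).
    specialize (fun Rs K P => IHb Rs K P hSb hnb).
    assert (na := vals_normal _ U a hSa). assert (nb := vals_normal _ U b hSb).
    assert (nw := vals_normal _ U _ hS).
    destruct (gen_vals_comm _ U a b na nb) as [W1 W2].
    set (V1 := gen (vals U a)) in *. set (V2 := gen (vals U b)) in *.
    set (W := gen (vals U (OComm a b))) in *.
    assert (hW : normal_subgroup W) by now apply gen_normal.
    assert (hV1 : normal_subgroup V1) by now apply gen_normal.
    assert (hV2 : normal_subgroup V2) by now apply gen_normal.
    assert (h12 : normal_subgroup (csub V1 V2)).
    { apply csub_normal; now apply normal_subgroup_subset. }
    set (ctx := fun s => repeat (vals U a) s ++ vals U b :: Rs).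
    assert (hctx : forall s, Forall normal_subset (ctx s)).
    { intros s. apply Forall_app. split; [|now constructor].
      apply Forall_forall. intros R HR. apply repeat_spec in HR. now subst. }
    (* The induction hypothesis only places powers inside its modulus, so the subgroup to be reached
       is made part of the modulus. *)
    set (Ks := fun s => setmul (lcsub W (ctx s)) K).
    assert (hA : forall s, normal_subgroup (lcsub W (ctx s))).
    { intros s. now apply lcsub_normal. }
    assert (hKs : forall s, normal_subgroup (Ks s)).
    { intros s. now apply setmul_normal. }
    assert (sK : forall s, sub K (Ks s)).
    { intros s. now apply setmul_r. }
    assert (sA : forall s, sub (lcsub W (ctx s)) (Ks s)).
    { intros s. now apply setmul_l. }
    (* W is read as [V2, V1], with V1 as first entry of the context. Interchanging the two sides
       inverts the values, whence [map ginv P]; the obstruction lies in [W, V2, Rs], hence in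
       [Ks 0]. *)
    assert (Hb : forall z, lcsub W Rs z -> Ks 0 (gpow z (oc_exponent b n (length P)))).
    { intros z Hz. replace (length P) with (length (map ginv P)) by now rewrite length_map.
      apply (IHb (vals U a :: Rs)); auto.
      - intros x ys Hx Hy. inversion Hy as [|y ? ys' ? Hy1 Hy2]; subst. simpl.
        rewrite <- ginv_comm.
        destruct (lcomm_inv _ Rs (gcomm y x) ys' hR Hy2) as (ys2 & Hy3 & ->).
        apply in_map, HP; auto. exists y, x. auto.
      - simpl. split.
        + revert HL. apply multiplicative_mod_antitone; [|apply sK].
          intros x Hx. apply W2. now apply csub_sym.
        + intros x Hx. apply sA. simpl. revert x Hx. apply lcsub_mono_l.
          apply csub_mono; [|unfold sub; auto]. intros x Hx. apply W2. now apply csub_sym.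
      - simpl. revert z Hz. apply lcsub_mono_l. intros x Hx. apply csub_sym. now apply W1. }
    (* Here W is read as [V1, V2], and the context is V2 followed by [ctx s]. The obstruction lies
       in [W, V1, ctx s], which is exactly the new part of [Ks (S s)]. The s + 1 entries added to
       [Rs] account for [iter_square (S s)]. *)
    assert (Ha : forall s z, Ks s z ->
      Ks (S s) (gpow z (oc_exponent a n (iter_square (S s) (length P))))).
    { intros s. apply setmul_exponent; auto. intros z Hz.
      destruct (finite_values_app _ (vals U (OComm a b)) (repeat (vals U a) s ++ [vals U b])
        Rs P) as (P' & E & HP'); auto.
      { apply Forall_app. split; [|now constructor].
        apply Forall_forall. intros R HR. apply repeat_spec in HR. now subst. }
      rewrite length_app, repeat_length, Nat.add_1_r in E. rewrite <- E.
      rewrite <- app_assoc in HP'. simpl in HP'.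
      apply (IHa (vals U b :: ctx s)); auto.
      - intros x ys Hx Hy. inversion Hy as [|y ? ys' ? Hy1 Hy2]; subst. simpl.
        apply HP'; auto. exists x, y. auto.
      - simpl. split.
        + unfold ctx. rewrite <- (app_nil_l Rs) at 1.
          change (vals U b :: [] ++ Rs) with ([vals U b] ++ Rs). rewrite app_assoc.
          apply multiplicative_mod_app with W; auto.
          * apply Forall_app. split; [|now constructor].
            apply Forall_forall. intros R HR. apply repeat_spec in HR. now subst.
          * revert HL. apply multiplicative_mod_antitone; [unfold sub; auto | apply sK].
        + intros x Hx. apply sA. simpl. revert x Hx.
          apply lcsub_mono_l. apply csub_mono; unfold sub; auto.
      - simpl. revert z Hz. apply lcsub_mono_l. exact W1. }
    assert (Hc : forall s z, Ks 0 z ->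
      Ks s (gpow z (nprod (fun s => oc_exponent a n (iter_square (S s) (length P))) s))).
    { induction s as [|s IHs]; intros z Hz; cbn [nprod].
      - simpl. now rewrite gmul_1r.
      - rewrite gpow_mul. apply Ha. auto. }
    intros z Hz. simpl. rewrite !(gpow_mul _ z).
    specialize (Hc (length (left_spine a)) _ (Hb z Hz)).
    revert Hc. apply setmul_exponent; auto; [unfold sub; auto|].
    intros c Hcc.
    apply exponent_of_finite_values with (X := W)
      (Rs := map (vals U) (left_spine a) ++ vals U b :: Rs); auto.
    + apply Forall_app. split; [now apply left_spine_normal | now constructor].
    + change (vals U b :: Rs) with ([vals U b] ++ Rs). rewrite app_assoc.
      apply multiplicative_mod_app with W; auto; [unfold sub; auto|].
      apply Forall_app. split; [now apply left_spine_normal | now constructor].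
    (* As W lies in the subgroup generated by the values of the leftmost variable, x^(nk) is an
       admissible value of it. The commutator is thus a w-value followed by entries from [Rs], so
       the original list [P] suffices. *)
    + intros x ys k Hx Hy.
      apply Forall2_app_inv_r in Hy as (zs & us & Hz' & Hu & ->).
      inversion Hu as [|y ? us' ? Hu1 Hu2]; subst.
      rewrite lcomm_app. simpl. apply HP; auto.
      eexists _, y. split; [|split; [exact Hu1 | reflexivity]].
      apply vals_left_spine; auto. rewrite Nat.mul_comm, gpow_mul.
      apply hna; [apply left_var_in|]. apply gpow_gen.
      apply gen_vals_left_var; auto. fold V1.
      apply (csub_sub_l _ _ V2); auto.
    + revert c Hcc. apply lcsub_mono; [unfold sub; auto|].
      unfold ctx. apply Forall2_app; [|apply sub_refl_Forall2].
      assert (h : forall u, In u (left_spine a) -> sub V1 (gen (vals U u))).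
      { intros. now apply gen_vals_left_spine. }
      revert h. generalize (left_spine a). intros us h.
      induction us as [|u us IH]; simpl; constructor.
      * apply h. now left.
      * apply IH. intros. apply h. now right.
Qed.

(** * The theorems of Dietzmann and Schur *)

Fixpoint gprod {G : Group} (u : list G) : G :=
  match u with [] => gone | x :: u' => gmul x (gprod u') end.

Lemma gprod_app (G : Group) (u v : list G) : gprod (u ++ v) = gmul (gprod u) (gprod v).
Proof. induction u; simpl; [|rewrite IHu]; grp. Qed.

Lemma gprod_repeat (G : Group) (x : G) k : gprod (repeat x k) = gpow x k.
Proof. induction k; simpl; congruence. Qed.

Definition eq_dec_classical {A : Type} (x y : A) : {x = y} + {x <> y} :=
  excluded_middle_informative (x = y).

Lemma length_le_count {A : Type} (l u : list A) c :
  incl u l -> (forall t, count_occ eq_dec_classical u t <= c) -> length u <= length l * c.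
Proof.
  revert u. induction l as [|t l IH]; intros u Hu Hc.
  - destruct u as [|x u]; auto. destruct (Hu x). now left.
  - assert (E : length u = count_occ eq_dec_classical u t +
      length (remove eq_dec_classical t u)).
    { clear. induction u as [|x u IH]; simpl; auto.
      destruct (eq_dec_classical x t), (eq_dec_classical t x); simpl; subst; lia || congruence. }
    assert (L : length (remove eq_dec_classical t u) <= length l * c).
    { apply IH.
      - intros x Hx. apply in_remove in Hx as [Hx ne].
        destruct (Hu x Hx); [congruence | auto].
      - intros x. apply Nat.le_trans with (count_occ eq_dec_classical u x); auto.
        clear. induction u as [|y u IH]; simpl; auto.
        destruct (eq_dec_classical t y), (eq_dec_classical y x); simpl;
          destruct (eq_dec_classical y x); simpl; subst; lia || congruence. }
    specialize (Hc t). simpl. lia.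
Qed.

(** By x t^k = t^k x^(t^k), every copy of [t] moves to the front and the other factors become
    conjugates, still in [T]. *)
Lemma gprod_pull (G : Group) (T : G -> Prop) (t : G) u :
  (forall s t, T s -> T t -> T (gconj s t)) -> T t -> Forall T u ->
  exists v, Forall T v /\ count_occ eq_dec_classical u t + length v = length u /\
    gprod u = gmul (gpow t (count_occ eq_dec_classical u t)) (gprod v).
Proof.
  intros hT Ht Hu. induction Hu as [|x u Hx Hu (v & Hv & L & E)].
  - exists []. repeat split; auto. simpl. grp.
  - simpl. destruct (eq_dec_classical x t) as [->|ne].
    + exists v. repeat split; auto; [simpl; lia|]. simpl. rewrite E. grp.
    + set (k := count_occ eq_dec_classical u t) in *.
      exists (gconj x (gpow t k) :: v). repeat split.
      * constructor; auto. clear - hT Hx Ht. revert x Hx.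
        induction k; intros x Hx; simpl.
        -- now grp_eq (gconj x gone) x.
        -- rewrite <- gconj_gconj. auto.
      * simpl. lia.
      * simpl. rewrite E. grp.
Qed.

(** In a longer product some [t] occurs at least e + 1 times; collecting these copies and replacing
    t^(e+1) by at most [e] factors shortens it. *)
Lemma short_products (G : Group) (T : G -> Prop) (l : list G) e :
  (forall t, T t -> In t l) -> (forall s t, T s -> T t -> T (gconj s t)) ->
  (forall t, T t -> exists u, Forall T u /\ length u <= e /\ gpow t (S e) = gprod u) ->
  forall u, Forall T u ->
  exists u', Forall T u' /\ length u' <= length l * e /\ gprod u' = gprod u.
Proof.
  intros hl hT he u. remember (length u) as N eqn:EN. revert u EN.
  induction N as [N IH] using lt_wf_ind. intros u -> Hu.
  destruct (Nat.le_gt_cases (length u) (length l * e)) as [L|L]; [exists u; auto|].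
  destruct (classic (forall t, count_occ eq_dec_classical u t <= e)) as [H|H].
  - apply (length_le_count l) in H; [lia|].
    intros x Hx. apply hl. rewrite Forall_forall in Hu. auto.
  - apply not_all_ex_not in H as [t Ht]. apply Nat.nle_gt in Ht.
    assert (Tt : T t).
    { rewrite Forall_forall in Hu. apply Hu.
      apply (count_occ_In eq_dec_classical). lia. }
    destruct (gprod_pull _ T t u hT Tt Hu) as (v & Hv & Lv & Ev).
    destruct (he t Tt) as (w & Hw & Lw & Ew).
    set (k := count_occ eq_dec_classical u t) in *.
    destruct (IH (length (w ++ repeat t (k - S e) ++ v))) with
      (u := w ++ repeat t (k - S e) ++ v) as (u' & H1 & H2 & H3); auto.
    + rewrite !length_app, repeat_length. lia.
    + apply Forall_app. split; auto. apply Forall_app. split; auto.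
      apply Forall_forall. intros x Hx. apply repeat_spec in Hx. now subst.
    + exists u'. repeat split; auto.
      rewrite H3, Ev, !gprod_app, gprod_repeat, <- Ew.
      rewrite gmul_assoc, <- gpow_add. do 2 f_equal. lia.
Qed.

(** The identity is offered as an extra factor, so shorter products are covered by padding. *)
Fixpoint products {G : Group} (l : list G) (L : nat) : list G :=
  match L with
  | 0 => [gone]
  | S L' => map (fun p => gmul (fst p) (snd p)) (list_prod (gone :: l) (products l L'))
  end.

Lemma length_products (G : Group) (l : list G) L : length (products l L) = S (length l) ^ L.
Proof.
  induction L as [|L IH]; [reflexivity|]. cbn [products].
  now rewrite length_map, length_prod, IH.
Qed.

Lemma gprod_in_products (G : Group) (l u : list G) L :
  incl u l -> length u <= L -> In (gprod u) (products l L).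
Proof.
  revert u. induction L as [|L IH]; intros u Hu HL.
  - destruct u; [now left | simpl in HL; lia].
  - cbn [products]. apply in_map_iff. destruct u as [|x u].
    + exists (gone, gprod []). split; [simpl; grp|].
      apply in_prod; [now left|]. apply IH; [intros x []|simpl; lia].
    + exists (x, gprod u). split; [reflexivity|]. apply in_prod.
      * right. apply Hu. now left.
      * apply IH; [|simpl in HL; lia]. intros y Hy. apply Hu. now right.
Qed.

(** Common core of both theorems: for Dietzmann t^(e+1) is the empty product, for Schur [T] is the
    set of commutators and t^(e+1) is a product of [e] of them. *)
Lemma finite_gen (G : Group) (T : G -> Prop) (l : list G) e :
  (forall t, T t -> In t l) -> (forall s t, T s -> T t -> T (gconj s t)) ->
  (forall t, T t -> exists u, Forall T u /\ length u <= e /\ gpow t (S e) = gprod u) ->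
  (forall t, T t -> exists u, Forall T u /\ ginv t = gprod u) ->
  exists l', length l' = S (length l) ^ (length l * e) /\ forall x, gen T x -> In x l'.
Proof.
  intros hl hT he hv. exists (products l (length l * e)).
  split; [apply length_products|]. intros x Hx.
  assert (H : exists u, Forall T u /\ x = gprod u).
  { induction Hx as [x Hx| |x y Hx (u & Hu & ->) Hy (v & Hv & ->)|x Hx (u & Hu & ->)].
    - exists [x]. split; [auto | simpl; grp].
    - exists []. auto.
    - exists (u ++ v). split; [now apply Forall_app | now rewrite gprod_app].
    - clear Hx. induction Hu as [|x u Hx Hu (v & Hv & E)].
      + exists []. split; auto. simpl. grp.
      + destruct (hv x Hx) as (w & Hw & Ew). exists (v ++ w).
        split; [now apply Forall_app|].
        rewrite gprod_app, <- E, <- Ew. simpl. now rewrite ginv_mul. }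
  destruct H as (u & Hu & ->).
  destruct (short_products _ T l e hl hT he u Hu) as (u' & H1 & H2 & <-).
  apply gprod_in_products; auto.
  intros y Hy. apply hl. rewrite Forall_forall in H1. auto.
Qed.

Lemma dietzmann (G : Group) (T : G -> Prop) (l : list G) e :
  (forall t, T t -> In t l) -> normal_subset T ->
  (forall t, T t -> gpow t (S e) = gone) ->
  exists l', length l' = S (length l) ^ (length l * e) /\ forall x, gen T x -> In x l'.
Proof.
  intros hl hT he. apply finite_gen; auto.
  - intros t Ht. exists []. repeat split; auto. simpl. lia.
  - intros t Ht. exists (repeat t e). split.
    + apply Forall_forall. intros x Hx. apply repeat_spec in Hx. now subst.
    + rewrite gprod_repeat. apply ginv_unique. exact (he t Ht).
Qed.

(** * Schur's theorem for a group generated by a finite normal set *)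

Lemma finite_image {A B C : Type} (D : A -> Prop) (f : A -> B) (g : A -> C) (l : list B) :
  (forall x, D x -> In (f x) l) ->
  (forall x y, D x -> D y -> f x = f y -> g x = g y) ->
  exists l', length l' <= length l /\ forall x, D x -> In (g x) l'.
Proof.
  intros H Hg. revert D H Hg. induction l as [|b l IH]; intros D H Hg.
  - exists []. auto.
  - destruct (IH (fun x => D x /\ f x <> b)) as (l' & L & H').
    + intros x [Hx ne]. destruct (H x Hx); [congruence | auto].
    + intros x y [Hx _] [Hy _]. auto.
    + destruct (classic (exists x, D x /\ f x = b)) as [(x & Hx & Ex)|no].
      * exists (g x :: l'). split; [simpl; lia|]. intros y Hy.
        destruct (classic (f y = b)) as [Ey|Ey].
        -- left. apply Hg; congruence.
        -- right. auto.
      * exists l'. split; [simpl; lia|]. intros y Hy. apply H'. split; auto.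
        intros Ey. apply no. eauto.
Qed.

Fixpoint tuples {A : Type} (l : list A) (k : nat) : list (list A) :=
  match k with
  | 0 => [[]]
  | S k' => map (fun p => fst p :: snd p) (list_prod l (tuples l k'))
  end.

Lemma length_tuples {A : Type} (l : list A) k : length (tuples l k) = length l ^ k.
Proof.
  induction k as [|k IH]; [reflexivity|]. cbn [tuples].
  now rewrite length_map, length_prod, IH.
Qed.

Lemma in_tuples {A : Type} (l u : list A) : incl u l -> In u (tuples l (length u)).
Proof.
  induction u as [|x u IH]; intros H; [now left|]. cbn [tuples length].
  apply in_map_iff. exists (x, u). split; [reflexivity|].
  apply in_prod; [apply H; now left|]. apply IH. intros y Hy. apply H. now right.
Qed.

(* Schur's trick: if c = [x, y] has c^e central then
   c^(e+1) = [x, y^2] (c^y)^(e-1) is a product of e commutators. *)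
Lemma gcomm_pow_succ (G : Group) (x y : G) e :
  gmul (gpow (gcomm x y) (S e)) y = gmul y (gpow (gcomm x y) (S e)) ->
  gpow (gcomm x y) (S (S e)) = gmul (gcomm x (gmul y y)) (gpow (gcomm (gconj x y) y) e).
Proof.
  intros H. change (gpow (gcomm x y) (S (S e))) with
    (gmul (gcomm x y) (gpow (gcomm x y) (S e))).
  transitivity (gmul (gmul (ginv x) (gmul (ginv y) x))
    (gmul y (gpow (gcomm x y) (S e)))).
  { generalize (gpow (gcomm x y) (S e)). intros z. grp. }
  rewrite <- H. simpl.
  assert (E : gpow (gcomm (gconj x y) y) e = gconj (gpow (gcomm x y) e) y).
  { rewrite gconj_pow. f_equal. grp. }
  rewrite E. generalize (gpow (gcomm x y) e). intros z. grp.
Qed.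

Lemma gconj_inj (G : Group) (x y g : G) : gconj x g = gconj y g -> x = y.
Proof.
  intros H. apply (f_equal (fun z => gconj z (ginv g))) in H.
  rewrite !gconj_gconj, gmul_Vr in H. revert H. grp. auto.
Qed.

Lemma gconj_fixed (G : Group) (x g : G) : gconj x g = x <-> gmul x g = gmul g x.
Proof.
  split; intros H.
  - rewrite <- H at 2. grp.
  - unfold gconj. rewrite H. grp.
Qed.

Lemma commute_gen (G : Group) (A : G -> Prop) g :
  (forall x, A x -> gmul x g = gmul g x) -> forall x, gen A x -> gmul x g = gmul g x.
Proof.
  intros H x Hx. induction Hx as [x Hx| |x y Hx IHx Hy IHy|x Hx IHx]; auto.
  - grp.
  - now rewrite gmul_assoc_r, IHy, gmul_assoc, IHx, gmul_assoc_r.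
  - apply (gmul_cancel_l G x). rewrite gmul_assoc, gmul_Vr, gmul_1l.
    rewrite gmul_assoc, IHx, gmul_assoc_r, gmul_Vr. grp.
Qed.

Lemma gcomm_commute_l (G : Group) (z x y : G) :
  gmul y z = gmul z y -> gcomm (gmul z x) y = gcomm x y.
Proof.
  intros H. assert (E : gmul (ginv z) (gmul y z) = y) by (rewrite H; grp).
  transitivity (gmul (ginv x) (gmul (ginv (gmul (ginv z) (gmul y z))) (gmul x y))).
  - grp.
  - rewrite E. grp.
Qed.

(** [x, y] depends only on how x and y conjugate the m generators, so there are at most c = m^m m^m
    commutators; the rest is the bound of [finite_gen] with e = m!. *)
Definition schur_bound (m : nat) : nat :=
  let c := m ^ m * m ^ m in S c ^ (c * fact m).

Lemma schur (G : Group) (T : G -> Prop) (l : list G) :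
  (forall t, T t <-> In t l) -> normal_subset T ->
  exists l', length l' <= schur_bound (length l) /\
    forall x, csub (gen T) (gen T) x -> In x l'.
Proof.
  intros hl hT. set (m := length l).
  set (act := fun x => map (fun t => gconj t x) l).
  (* Equal action on the generators means that x y^-1 centralizes the whole generated subgroup. *)
  assert (Hact : forall x y, act x = act y ->
    forall t, gen T t -> gmul t (gmul x (ginv y)) = gmul (gmul x (ginv y)) t).
  { intros x y E. apply commute_gen. intros t Ht. apply gconj_fixed.
    rewrite <- gconj_gconj. apply hl in Ht.
    assert (Et : gconj t x = gconj t y).
    { unfold act in E. clear - E Ht. induction l as [|s l IH]; [destruct Ht|].
      injection E as E1 E2. destruct Ht as [->|Ht]; auto. }
    rewrite Et. grp. }
  assert (Hc : forall x y z, act x = act y -> gen T z -> gcomm x z = gcomm y z).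
  { intros x y z E Hz. grp_eq x (gmul (gmul x (ginv y)) y).
    apply gcomm_commute_l. now apply Hact. }
  destruct (finite_image (fun p => gen T (fst p) /\ gen T (snd p))
    (fun p => (act (fst p), act (snd p))) (fun p => gcomm (fst p) (snd p))
    (list_prod (tuples l m) (tuples l m))) as (lc & Lc & Hlc).
  { assert (Hin : forall x, In (act x) (tuples l m)).
    { intros x. replace m with (length (act x)) by apply length_map.
      apply in_tuples. intros y Hy. apply in_map_iff in Hy as (t & <- & Ht).
      apply hl, hT. now apply hl. }
    intros [x y] _. apply in_prod; apply Hin. }
  { intros [x y] [x' y'] [Hx Hy] [Hx' Hy'] E. simpl in *. injection E as E1 E2.
    rewrite (Hc x x' y) by auto. rewrite <- !(ginv_comm _ _ x').
    now rewrite (Hc y y' x'). }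
  rewrite length_prod, !length_tuples in Lc. fold m in Lc.
  assert (Hm : exists e, fact m = S e).
  { exists (pred (fact m)). generalize (lt_O_fact m). lia. }
  destruct Hm as [e He].
  (* Conjugation by x permutes [T], so each orbit has length at most m and x^(m!) fixes every
     generator. *)
  assert (Hcentral : forall x z, gen T z -> gmul z (gpow x (fact m)) = gmul (gpow x (fact m)) z).
  { intros x. apply commute_gen. intros t Ht.
    destruct (pigeonhole_nat (fun k => gconj t (gpow x k)) l) as (j & k & Hjk & E).
    { intros k. now apply hl, hT. }
    destruct (divide_fact (k - j) m) as [q ->]; [unfold m; lia|].
    rewrite Nat.mul_comm, gpow_mul.
    assert (Hd : gconj t (gpow x (k - j)) = t).
    { replace k with (k - j + j) in E by lia. rewrite gpow_add, <- gconj_gconj in E.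
      now apply gconj_inj in E. }
    symmetry. apply (commute_gen _ (eq (gpow x (k - j)))).
    - intros ? <-. symmetry. now apply gconj_fixed.
    - now apply gpow_gen, gen_in. }
  destruct (finite_gen G (cset (gen T) (gen T)) lc (fact m)) as (l' & L' & Hl').
  - intros z (x & y & Hx & Hy & ->). now apply (Hlc (x, y)).
  - intros s t Hs _. revert s t Hs. apply cset_normal; now apply gen_normal_subset.
  - intros z (x & y & Hx & Hy & ->).
    exists (gcomm x (gmul y y) :: repeat (gcomm (gconj x y) y) e). split; [|split].
    + constructor.
      * exists x, (gmul y y). repeat split; auto. now apply gen_mul.
      * apply Forall_forall. intros z Hz. apply repeat_spec in Hz as ->.
        exists (gconj x y), y. repeat split; auto. now apply gen_normal_subset.
    + simpl. rewrite repeat_length. lia.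
    + rewrite He. simpl gprod. rewrite gprod_repeat. apply gcomm_pow_succ.
      rewrite <- He. symmetry. now apply Hcentral.
  - intros z (x & y & Hx & Hy & ->). exists [gcomm y x]. split.
    + constructor; [|constructor]. exists y, x. auto.
    + simpl. grp.
  - exists l'. split; [|exact Hl']. rewrite L'. unfold schur_bound. fold m.
    apply Nat.le_trans with (S (m ^ m * m ^ m) ^ (length lc * fact m)).
    + apply Nat.pow_le_mono_l. lia.
    + apply Nat.pow_le_mono_r; [lia|]. now apply Nat.mul_le_mono_r.
Qed.

(** * The order of an outer commutator subgroup *)

(** Distinctness of the variables lets the assignments for the two sides be glued into one. *)
Lemma wvalues_vals (G : Group) (S : nat -> G -> Prop) w :
  NoDup (ocvars w) -> forall x, wvalues w S x <-> vals S w x.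
Proof.
  induction w as [i|a IHa b IHb]; simpl; intros H x.
  - split.
    + intros (g & Hg & ->). apply Hg. now left.
    + intros Hx. exists (fun _ => x). split; auto. intros j [<-|[]]. auto.
  - assert (Ha := NoDup_app_remove_r _ _ H). assert (Hb := NoDup_app_remove_l _ _ H).
    specialize (IHa Ha). specialize (IHb Hb). split.
    + intros (g & Hg & ->). exists (oceval a g), (oceval b g). repeat split.
      * apply IHa. exists g. split; auto. intros; apply Hg, in_or_app; auto.
      * apply IHb. exists g. split; auto. intros; apply Hg, in_or_app; auto.
    + intros (y & z & Hy & Hz & ->).
      apply IHa in Hy as (g & Hg & ->). apply IHb in Hz as (h & Hh & ->).
      set (k := fun i => if in_dec Nat.eq_dec i (ocvars a) then g i else h i).
      assert (ext : forall w (g h : nat -> G), (forall i, In i (ocvars w) -> g i = h i) ->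
        oceval w g = oceval w h).
      { clear. induction w as [i|a IHa b IHb]; simpl; intros g h E; auto.
        rewrite (IHa g h), (IHb g h); auto; intros; apply E, in_or_app; auto. }
      assert (kb : forall i, In i (ocvars b) -> k i = h i).
      { intros i Hi. unfold k. destruct (in_dec Nat.eq_dec i (ocvars a)) as [Hi'|]; auto.
        destruct (in_split _ _ Hi') as (u & v & E). rewrite E, <- app_assoc in H.
        apply NoDup_app_remove_l in H. simpl in H. inversion H as [|? ? Hn _]; subst.
        destruct Hn. apply in_or_app. auto. }
      assert (ka : forall i, In i (ocvars a) -> k i = g i).
      { intros i Hi. unfold k. now destruct (in_dec Nat.eq_dec i (ocvars a)). }
      exists k. split.
      * intros i Hi. apply in_app_or in Hi as [Hi|Hi]; [rewrite ka | rewrite kb]; auto.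
      * simpl. now rewrite (ext a k g), (ext b k h).
Qed.

(** For normal sets the commutator subgroup of the generated subgroups is generated by commutators
    of the generators; applied along the word, this makes w{S} generate w(N). *)
Lemma gen_vals_gen (G : Group) (N S : nat -> G -> Prop) w :
  (forall i, In i (ocvars w) -> normal_subset (S i)) ->
  (forall i, In i (ocvars w) -> normal_subset (N i)) ->
  (forall i, In i (ocvars w) -> sub (N i) (gen (S i))) ->
  sub (gen (vals N w)) (gen (vals S w)).
Proof.
  induction w as [i|a IHa b IHb]; simpl; intros hS hN H.
  - apply gen_mono. auto.
  - intros x Hx.
    apply (gen_vals_comm _ S a b); try (apply vals_normal; intros; apply hS, in_or_app; auto).
    apply (gen_vals_comm _ N a b) in Hx;
      try (apply vals_normal; intros; apply hN, in_or_app; auto).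
    revert x Hx. apply csub_mono; [apply IHa | apply IHb]; intros; auto using in_or_app.
Qed.

Lemma has_card_sub_list {A : Type} (D : A -> Prop) (l : list A) :
  (forall x, D x -> In x l) -> exists k, has_card D k /\ k <= length l.
Proof.
  intros H.
  assert (Hl : exists l', NoDup l' /\ length l' <= length l /\ forall x, D x <-> In x l').
  { revert D H. induction l as [|b l IH]; intros D H.
    - exists []. repeat split; auto; [constructor | intros []].
    - destruct (IH (fun x => D x /\ x <> b)) as (l' & nd & L & H').
      { intros x [Hx ne]. destruct (H x Hx); [congruence | auto]. }
      destruct (classic (D b)) as [Hb|Hb].
      + exists (b :: l'). split; [|split].
        * constructor; auto. intros Hi. now apply H' in Hi.
        * simpl. lia.
        * intros x. split.
          -- intros Hx. destruct (classic (x = b)) as [->|ne]; [now left|].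
             right. now apply H'.
          -- intros [<-|Hx]; auto. now apply H'.
      + exists l'. split; [|split]; auto; [simpl; lia|].
        intros x. rewrite <- H'. split; [|tauto]. intros Hx. split; congruence. }
  destruct Hl as (l' & nd & L & H'). exists (length l'). split; auto. exists l'. auto.
Qed.

(** [oc_exponent] bounds the exponent of W/W' and the factorial that of W'; their product kills each
    of the m generators, and Dietzmann's bound follows. *)
Definition order_bound (w : ocword) (n : nat -> nat) (m : nat) : nat :=
  S m ^ (m * (oc_exponent w n m * fact (schur_bound m))).

Lemma finite_vals (w : ocword) (n : nat -> nat) (G : Group) (U : nat -> G -> Prop)
    (l : list G) :
  (forall i, In i (ocvars w) -> normal_subset (U i)) ->
  (forall i, In i (ocvars w) -> 0 < n i) ->
  (forall i, In i (ocvars w) -> forall x, gen (U i) x -> U i (gpow x (n i))) ->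
  (forall x, vals U w x <-> In x l) ->
  exists l', length l' <= order_bound w n (length l) /\
    forall x, gen (vals U w) x -> In x l'.
Proof.
  intros hU n0 hn hl. set (T := vals U w) in *.
  assert (nT : normal_subset T) by now apply vals_normal.
  assert (nW := gen_normal _ _ nT). assert (nW' := normal_subgroup_subset _ _ nW).
  destruct (schur _ T l hl nT) as (ld & Ld & Hd).
  set (E := oc_exponent w n (length l)) in *.
  set (F := fact (schur_bound (length l))) in *.
  assert (E0 : 0 < E) by now apply oc_exponent_pos.
  assert (F0 : 0 < F) by apply lt_O_fact.
  assert (HE : forall t, T t -> gpow t (E * F) = gone).
  { intros t Ht. rewrite gpow_mul.
    assert (Hx : csub (gen T) (gen T) (gpow t E)).
    (* Empty context and modulus W': multiplicativity then says only that W' lies in W'. *)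
    { apply (oc_exponent_spec w n G U [] _ l); auto.
      - now apply csub_normal.
      - intros x ys Hx Hy. inversion Hy; subst. now apply hl.
      - simpl. unfold sub. auto.
      - now apply gen_in. }
    set (x := gpow t E) in *.
    destruct (pigeonhole_nat (fun k => gpow x k) ld) as (j & k & Hjk & Ejk).
    { intros k. now apply Hd, gpow_gen. }
    destruct (divide_fact (k - j) (schur_bound (length l))) as [q Eq]; [lia|].
    unfold F. rewrite Eq, Nat.mul_comm, gpow_mul.
    replace k with (j + (k - j)) in Ejk by lia. rewrite gpow_add in Ejk.
    rewrite <- (gmul_1r _ (gpow x j)) in Ejk at 1. apply gmul_cancel_l in Ejk.
    now rewrite <- Ejk, gpow_one. }
  destruct (dietzmann _ T l (pred (E * F))) as (l' & L' & Hl'); auto.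
  - intros t Ht. apply hl. auto.
  - intros t Ht. rewrite Nat.succ_pred; auto. lia.
  - exists l'. split; auto. rewrite L'. unfold order_bound. fold E F.
    apply Nat.pow_le_mono_r; [lia|]. apply Nat.mul_le_mono_l. lia.
Qed.

(** * A bound uniform in the word *)

(** The bound may depend on r but not on w, so a maximum is taken over a finite list of words.
    Nesting depth d covers d + 1 variable occurrences, since each side of a commutator has at least
    one. *)
Fixpoint ocwords (r d : nat) : list ocword :=
  match d with
  | 0 => map OVar (seq 0 r)
  | S d' => ocwords r d' ++
      map (fun p => OComm (fst p) (snd p)) (list_prod (ocwords r d') (ocwords r d'))
  end.

Lemma in_ocwords r d w :
  incl (ocvars w) (seq 0 r) -> length (ocvars w) <= S d -> In w (ocwords r d).
Proof.
  assert (pos : forall w, 0 < length (ocvars w)).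
  { induction w0; simpl; [|rewrite length_app]; lia. }
  revert w. induction d as [|d IH]; intros w Hi L.
  - destruct w as [i|a b].
    + apply in_map, Hi. now left.
    + simpl in L. rewrite length_app in L. generalize (pos a), (pos b). lia.
  - simpl. apply in_or_app. destruct w as [i|a b].
    + left. apply IH; auto. simpl. lia.
    + right. apply in_map_iff. exists (a, b). split; [reflexivity|].
      simpl in L. rewrite length_app in L. generalize (pos a), (pos b). intros pa pb.
      apply in_prod; apply IH; try lia; intros x Hx; apply Hi, in_or_app; auto.
Qed.

Theorem theorem1p2 :
  exists f : nat -> nat -> list nat -> nat,
  forall (G : Group) (r : nat) (w : ocword) (N S : nat -> G -> Prop)
         (n : nat -> nat) (m : nat),
    is_ocword w r ->
    (forall i, i < r -> normal_subgroup (N i)) ->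
    (forall i, i < r -> forall x, N i x <-> gen (S i) x) ->
    (forall i, i < r -> normal_subset (S i)) ->
    (forall i, i < r -> 0 < n i) ->
    (forall i, i < r -> forall x, N i x -> S i (gpow x (n i))) ->
    has_card (wvalues w S) m ->
    exists k, has_card (wsubgroup w N) k /\ k <= f m r (map n (seq 0 r)).
Proof.
  exists (fun m r l =>
    list_max (map (fun w => order_bound w (fun i => nth i l 0) m) (ocwords r r))).
  intros G r w N U n m hw hN hNU hU n0 hn (l & _ & <- & hl).
  assert (vars : forall i, In i (ocvars w) -> i < r).
  { intros i Hi. apply (Permutation_in _ hw), in_seq in Hi. lia. }
  assert (nd : NoDup (ocvars w)).
  { apply (Permutation_NoDup (Permutation_sym hw)), seq_NoDup. }
  (* The bound sees the exponents only as a list; the default 0 is returned only at indices at least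
     r, which do not occur in w. *)
  set (n' := fun i => nth i (map n (seq 0 r)) 0).
  assert (En : forall i, i < r -> n' i = n i).
  { intros i Hi. unfold n'. rewrite nth_indep with (d' := n 0).
    - now rewrite map_nth, seq_nth.
    - now rewrite length_map, length_seq. }
  destruct (finite_vals w n' G U l) as (l' & L' & Hl').
  - auto.
  - intros i Hi. rewrite En; auto.
  - intros i Hi x Hx. rewrite En by auto. apply hn; auto. apply hNU; auto.
  - intros x. rewrite <- wvalues_vals; auto.
  - destruct (has_card_sub_list (wsubgroup w N) l') as (k & Hk & Lk).
    + intros x Hx. apply Hl'. apply (gen_vals_gen _ N U); auto.
      * intros i Hi. apply normal_subgroup_subset. auto.
      * intros i Hi y Hy. now apply hNU; auto.
      * revert x Hx. apply gen_mono. intros x Hx. apply gen_in. now apply wvalues_vals.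
    + exists k. split; auto.
      apply Nat.le_trans with (1 := Lk), Nat.le_trans with (1 := L').
      assert (Hmax := proj1 (list_max_le _ _) (le_n (list_max
        (map (fun w => order_bound w n' (length l)) (ocwords r r))))).
      rewrite Forall_forall in Hmax. apply Hmax.
      apply in_map with (f := fun w => order_bound w n' (length l)).
      apply in_ocwords.
      * intros i Hi. apply in_seq. split; [lia|]. simpl. auto.
      * rewrite (Permutation_length hw), length_seq. lia.
Qed.
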